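(* Let $\Sigma$ be a finite alphabet. The class of languages over $\Sigma$ recognized by systems of linear recurrence equations with coefficients in $\mathcal{P}(\Sigma)$ is closed under union, concatenation, and the Kleene star. That is, if $L_1$ and $L_2$ are languages over $\Sigma$ each recognized by a system of linear recurrence equations with coefficients in $\mathcal{P}(\Sigma)$, then each of the languages $L_1 \cup L_2$, $L_1 \cdot L_2$, and $L_1^*$ is recognized by a system of linear recurrence equations with coefficients in $\mathcal{P}(\Sigma)$.
   Context: $\Sigma$ is a finite alphabet, $\Sigma^*$ is the set of finite words over $\Sigma$, and $\varepsilon$ is the empty word. The semiring of languages is $(\mathcal{P}(\Sigma^* ), \cup, \cdot, \emptyset, \{\varepsilon\})$, where $\mathcal{P}$ denotes the power set and $\cdot$ is concatenation of languages. $\mathcal{P}(\Sigma)$ is regarded as the subset of $\mathcal{P}(\Sigma^* )$ consisting of the languages all of whose words have length exactly 1 (sets of letters, including $\emptyset$). A system of linear recurrence equations with coefficients in $\mathcal{P}(\Sigma)$ is a system $$f_i(n+1) = \bigcup_{j=1}^k L_{ij} \cdot f_j(n), \quad f_i(0) = c_i, \quad 1 \le i \le k,$$ for functions $f_1, \ldots, f_k : \mathbb{N} \to \mathcal{P}(\Sigma^* )$ (with $0 \in \mathbb{N}$), where $k \ge 1$, $L_{ij} \in \mathcal{P}(\Sigma)$ for all $1 \le i,j \le k$, and each initial value $c_i$ is either $\emptyset$ or $\{\varepsilon\}$. The language recognized by the system is $\mathcal{L} = \bigcup_{n \in \mathbb{N}} f_1(n)$. *)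

(* Defs.v *)
From mathcomp Require Import all_boot.
From mathcomp Require Import boolp classical_sets.

Set Implicit Arguments.
Unset Strict Implicit.
Unset Printing Implicit Defensive.

Local Open Scope classical_set_scope.

Definition language (Sigma : finType) := set (seq Sigma).

Section Languages.
Variable Sigma : finType.
Implicit Types A B : language Sigma.

Definition lang_eps : language Sigma := [set [::]].

Definition lang_cat A B : language Sigma := [set u ++ v | u in A & v in B].

Definition lang_exp A (n : nat) : language Sigma := iter n (lang_cat A) lang_eps.

Definition lang_star A : language Sigma := \bigcup_n lang_exp A n.

(* P(Sigma) as a subset of P(Sigma^* ): a letter a is the word [:: a]. *)
Definition letter_languages : set (language Sigma) :=
  [set A | A `<=` [set w | size w = 1]].

(* A system of k.+1 equations, so that there is always a first one, which
   has index ord0; every index is shifted down by one. *)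
Record linrec_system (k : nat) := LinRecSystem {
  coef : 'I_k.+1 -> 'I_k.+1 -> language Sigma;
  init : 'I_k.+1 -> language Sigma;
  coef_letters : forall i j, letter_languages (coef i j);
  init_eps : forall i, init i = set0 \/ init i = lang_eps
}.

Definition linrec_solution k (s : linrec_system k)
    (f : 'I_k.+1 -> nat -> language Sigma) : Prop :=
  (forall i, f i 0 = init s i) /\
  (forall i n, f i n.+1 = \bigcup_j lang_cat (coef s i j) (f j n)).

(* The solution of a system exists and is unique, hence the existential
   quantification over f. *)
Definition linrec_recognizes k (s : linrec_system k) A : Prop :=
  exists2 f, linrec_solution s f & A = \bigcup_n f ord0 n.

Definition linrec_recognizable A : Prop :=
  exists k (s : linrec_system k), linrec_recognizes s A.

End Languages.

(* Main.v *)
Require Import Defs.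
From mathcomp Require Import all_boot.
From mathcomp Require Import boolp classical_sets.
From mathcomp Require Import cardinality.

Local Open Scope classical_set_scope.

(** A language [X] is recognized by a system iff there is a finite set [F] of
    languages such that every residual of [X] and of each member of [F] is a
    union of members of [F]: the languages [\bigcup_n f_i n] form such a set,
    and conversely [X] and the members of [F] can be taken as unknowns.  Such
    sets are easy to combine, since the residuals of [X Y] are unions of
    languages [X' Y] and [Y'], and those of [X^*] are of the form [X' X^*],
    where [X'] and [Y'] are residuals of [X] and [Y]. *)

Section Residuals.
Variable Sigma : finType.
Implicit Types (X Y B : language Sigma) (F G : set (language Sigma)).

Definition residual (a : Sigma) X : language Sigma := [set w | X (a :: w)].

(* Every [residual a X] is the union of the members of [F] included in it. *)
Definition residuals_spanned F X :=
  forall a w, residual a X w ->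
    exists2 B, F B & B w /\ B `<=` residual a X.

Lemma residuals_spanned_sub F G X :
  F `<=` G -> residuals_spanned F X -> residuals_spanned G X.
Proof.
by move=> sFG FX a w /FX[B FB HB]; exists B => //; apply: sFG.
Qed.

Lemma residuals_spannedU F G X Y :
  residuals_spanned F X -> residuals_spanned G Y ->
  residuals_spanned (F `|` G) (X `|` Y).
Proof.
move=> FX GY a w [/FX|/GY] [B HB [Bw sB]].
  by exists B; [left | split => // v /sB; left].
by exists B; [right | split => // v /sB; right].
Qed.

(** The letter [a] is read by the factor in [X], or by the factor in [Y] when the former is empty.
    In the second case [[::]] belongs to [X], so that [residual a Y] is included in the residual of
    the product. *)
Lemma residuals_spanned_cat F G X Y :
  residuals_spanned F X -> residuals_spanned G Y ->
  residuals_spanned ([set lang_cat B Y | B in F] `|` G) (lang_cat X Y).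
Proof.
move=> FX GY a w [[|b u] Xu [v Yv /=]].
  move=> vE; rewrite vE in Yv.
  have [B GB [Bw sB]] := GY _ _ Yv.
  exists B; [by right | split => // z /sB Yz].
  by exists [::] => //; exists (a :: z).
case=> ba <-; rewrite ba in Xu.
have [B FB [Bu sB]] := FX _ _ Xu.
exists (lang_cat B Y); [by left; exists B | split].
  by exists u => //; exists v.
by move=> _ [x /sB Xx [y Yy <-]]; exists (a :: x) => //; exists y.
Qed.

Lemma lang_cat_star X : lang_cat X (lang_star X) `<=` lang_star X.
Proof.
by move=> _ [u Xu [v [n _ Xv] <-]]; exists n.+1 => //; exists u => //; exists v.
Qed.

(** By induction on the exponent, empty leading factors are dropped until one starts with [a]. *)
Lemma residual_star a X :
  residual a (lang_star X) `<=` lang_cat (residual a X) (lang_star X).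
Proof.
move=> w [n _]; elim: n => [//|n IHn] [[|b u] Xu [v Xv /=]].
  by move=> vE; apply: IHn; rewrite -vE.
by case=> ba <-; rewrite ba in Xu; exists u => //; exists v => //; exists n.
Qed.

Lemma residuals_spanned_star F X :
  residuals_spanned F X ->
  residuals_spanned [set lang_cat B (lang_star X) | B in F] (lang_star X).
Proof.
move=> FX a _ /residual_star[u /FX[B FB [Bu sB]] [v Xv <-]].
exists (lang_cat B (lang_star X)); [by exists B | split].
  by exists u => //; exists v.
move=> _ [x /sB Xx [y Xy <-]]; apply: lang_cat_star.
by exists (a :: x) => //; exists y.
Qed.

Definition residually_finite X :=
  exists F, [/\ finite_set F, forall B, F B -> residuals_spanned F B
              & residuals_spanned F X].

Lemma residually_finiteU X Y :
  residually_finite X -> residually_finite Y -> residually_finite (X `|` Y).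
Proof.
move=> [F [finF FF FX]] [G [finG GG GY]].
exists (F `|` G); split; first by rewrite finite_setU.
- move=> B [/FF|/GG]; first exact/residuals_spanned_sub/subsetUl.
  exact/residuals_spanned_sub/subsetUr.
- exact: residuals_spannedU.
Qed.

Lemma residually_finite_cat X Y :
  residually_finite X -> residually_finite Y ->
  residually_finite (lang_cat X Y).
Proof.
move=> [F [finF FF FX]] [G [finG GG GY]].
exists ([set lang_cat B Y | B in F] `|` G); split.
- by rewrite finite_setU; split => //; apply: finite_image.
- move=> C [[B FB <-]|/GG]; first exact/residuals_spanned_cat/GY/FF.
  exact/residuals_spanned_sub/subsetUr.
- exact: residuals_spanned_cat.
Qed.

Lemma residually_finite_star X :
  residually_finite X -> residually_finite (lang_star X).
Proof.
move=> [F [finF FF FX]]; have FsX := residuals_spanned_star _ _ FX.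
exists [set lang_cat B (lang_star X) | B in F]; split => //.
  exact: finite_image.
(* [lang_star X] is spanned by the very set that the left factor [B] contributes, so both sides of
   the union given by [residuals_spanned_cat] coincide. *)
move=> _ [B FB <-]; rewrite -[X in residuals_spanned X]setUid.
exact/residuals_spanned_cat/FsX/FF.
Qed.

Lemma linrec_recognizable_residually_finite X :
  linrec_recognizable X -> residually_finite X.
Proof.
move=> [k [s [f [f0 fS] ->]]].
pose A i := \bigcup_n f i n.
have spA i : residuals_spanned (range A) (A i).
  (* An initial value does not contain the nonempty word [a :: w]. *)
  move=> a w [[_|n _]]; first by rewrite f0; case: (init_eps s i) => ->.
  rewrite fS => -[j _ [u su [v fv]]].
  move: (coef_letters su) => /=; case: u su => [|b [|//]] //= su _ [ba vw].
  rewrite {}ba {}vw in su fv.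
  exists (A j); [by exists j | split; first by exists n].
  move=> z [m _ fz]; exists m.+1 => //; rewrite fS.
  by exists j => //; exists [:: a] => //; exists z.
exists (range A); split; first exact/finite_image/finite_finset.
  by move=> _ [i _ <-].
exact: (spA ord0).
Qed.

Lemma residually_finite_linrec_recognizable X :
  residually_finite X -> linrec_recognizable X.
Proof.
move=> [F [/finite_seqP[s ->] FF FX]].
(* [X] comes first because the recognized language is read off [ord0]; members of [s] are thus
   shifted by one. *)
pose B (i : 'I_(size s).+1) := nth X (X :: s) i.
have spB i : residuals_spanned [set` s] (B i).
  rewrite /B; case: i => -[//|i] /= i_s.
  by apply: FF; apply: mem_nth.
(* Largest coefficients [L_ij] with [L_ij B_j] included in [B_i]. *)
pose c i j := [set [:: a] | a in [set a | B j `<=` residual a (B i)]].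
pose e i := B i `&` @lang_eps Sigma.
have c_letters i j : letter_languages (c i j) by move=> _ [a _ <-].
have e_eps i : e i = set0 \/ e i = @lang_eps Sigma.
  have [Bi|nBi] := pselect (B i [::]); [right | left]; apply/seteqP; split => w.
  - by case.
  - by move=> ->.
  - by case=> + w0; rewrite w0.
  - by [].
exists (size s), (LinRecSystem c_letters e_eps).
(* Each step of the recurrence prepends one letter, so [n] counts the length of the words. *)
exists (fun i n => B i `&` [set w | size w = n]); last first.
  by apply/seteqP; split => [w Xw|w [n _ []]//]; exists (size w).
split => [i|i n] /=; apply/seteqP; split.
- by move=> w [Bw /size0nil].
- by move=> w [Bw w0]; split; rewrite // w0.
(* Spanning provides a member [D] of [s] that contains the tail [w] and whose coefficient contains
   [[:: a]]. *)
- case=> [|a w] [Bw] //= [sw].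
  have [D /= sD [Dw sDB]] := spB _ _ _ Bw.
  have Dlt : (index D s).+1 < (size s).+1 by rewrite ltnS index_mem.
  have BD : B (Ordinal Dlt) = D by rewrite /B /= nth_index.
  exists (Ordinal Dlt) => //; exists [:: a]; first by exists a; rewrite //= BD.
  by exists w => //; rewrite BD.
- move=> _ [j _ [_ [a /= sB <-] [v [Bv <-] <-]]].
  by split => //; apply: sB.
Qed.

End Residuals.

Theorem corollary4p2 (Sigma : finType) (L1 L2 : language Sigma)
    (hL1 : linrec_recognizable L1) (hL2 : linrec_recognizable L2) :
  linrec_recognizable (L1 `|` L2) /\
  linrec_recognizable (lang_cat L1 L2) /\
  linrec_recognizable (lang_star L1).
Proof.
have /linrec_recognizable_residually_finite fin1 := hL1.
have /linrec_recognizable_residually_finite fin2 := hL2.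
split; [|split]; apply: residually_finite_linrec_recognizable.
- exact: residually_finiteU.
- exact: residually_finite_cat.
- exact: residually_finite_star.
Qed.
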